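(* Let $(M,d)$ be a separable metric space, let $\phi=(\phi(x),\,x\in M)$ be a real-valued random field on a probability space $(\Omega,\mathcal{A},P)$, let $\rho>0$, and let $r,q:[0,\rho)\to[0,\infty)$ be strictly increasing functions with $r(0)=q(0)=0$. Suppose that for all $x,y\in M$ with $d(x,y)<\rho$, $$P\Bigl(\bigl|\phi(x)-\phi(y)\bigr|>r\bigl(d(x,y)\bigr)\Bigr)\le q\bigl(d(x,y)\bigr).$$ Suppose moreover that the following hold. (a) There exist an at most countable open cover $(U_n,\,n\in\mathbb{N})$ of $M$ and, for every $n\in\mathbb{N}$, a metric $d_n$ on $U_n$ and a number $\alpha_n\in(0,1]$ such that $\alpha_n d_n(x,y)\le d(x,y)\le d_n(x,y)$ for all $x,y\in U_n$. (b) For every $n\in\mathbb{N}$: (i) there exists an increasing sequence $(D_{n,k},\,k\in\mathbb{N})$ of finite subsets of $U_n$ such that $D_n=\bigcup_k D_{n,k}$ is dense in $(U_n,d_n)$; let $\delta_{n,k}$ denote the minimal distance of distinct points in $D_{n,k}$ with respect to $d_n$, and for $x\in D_{n,k}$ let $C_{n,k}(x)=\{y\in D_{n,k}:\ d_n(x,y)\le\delta_{n,k}\}$; (ii) every $z\in U_n$ has a neighborhood $V\subset U_n$ such that for all but finitely many $k\in\mathbb{N}$ and all $x,y\in D_{n,k+1}\cap V$ there exist $x',y'\in D_{n,k}\cap V$ with $x'\in C_{n,k+1}(x)$, $y'\in C_{n,k+1}(y)$ and $d_n(x',y')\le d_n(x,y)$. (c) For $n,k\in\mathbb{N}$ let $\pi_{n,k}$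 be the set of all unordered pairs $\langle x,y\rangle$ with $x,y\in D_{n,k}$ and $d_n(x,y)\le\delta_{n,k}$, and let $|\pi_{n,k}|$ be its cardinality. Then for every $n\in\mathbb{N}$, $$\sum_k|\pi_{n,k}|\,q(\delta_{n,k})<+\infty\qquad\text{and}\qquad\sum_k r(\delta_{n,k})<+\infty .$$ Then $\phi$ has a locally uniformly continuous modification.
   Context: A real-valued random field $\phi$ on $(\Omega,\mathcal{A},P)$ indexed by $M$ is a family of real-valued random variables $\phi(x)$, $x\in M$. A modification of $\phi$ is a random field $\psi=(\psi(x),\,x\in M)$ on the same probability space such that $P(\psi(x)=\phi(x))=1$ for every $x\in M$. It is locally uniformly continuous if for every $\omega\in\Omega$ the map $\psi(\cdot,\omega):M\to\mathbb{R}$ is locally uniformly continuous, i.e. every $z\in M$ has a neighborhood (possibly depending on $\omega$) on which $\psi(\cdot,\omega)$ is uniformly continuous with respect to $d$. Since $r$ and $q$ are defined only on $[0,\rho)$, it is understood in (c) that $\delta_{n,k}<\rho$ for all sufficiently large $k$ and that the series run over such sufficiently large $k$. *)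

(* Defs.v *)
From HB Require Import structures.
From mathcomp Require Import all_boot all_order all_algebra.
From mathcomp Require Import finmap.
From mathcomp Require Import all_classical all_reals all_analysis.

Set Implicit Arguments.
Unset Strict Implicit.
Unset Printing Implicit Defensive.

Import Order.TTheory GRing.Theory Num.Theory.
Import numFieldNormedType.Exports.

Local Open Scope classical_set_scope.
Local Open Scope ring_scope.

Definition separable_space (T : topologicalType) : Prop :=
  exists2 S : set T, countable S & dense S.

Section LocalMetric.
Context {R : realType} {T : choiceType}.
Implicit Types (dist : T -> T -> R) (U D : set T).

(* A metric on a subset U is represented by a function on the whole type whose
   values outside U are irrelevant. *)
Definition metric_on U dist : Prop :=
  [/\ forall x y, U x -> U y -> 0 <= dist x y,
      forall x y, U x -> U y -> (dist x y = 0 <-> x = y),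
      forall x y, U x -> U y -> dist x y = dist y x &
      forall x y z, U x -> U y -> U z -> dist x z <= dist x y + dist y z].

Definition dense_on U dist D : Prop :=
  forall x, U x -> forall e, 0 < e -> exists2 y, D y & dist x y < e.

(* For a finite D with at least two points the infimum is the minimal distance
   of distinct points.  If D has at most one point there is no such distance,
   and the value is inf set0 = 0. *)
Definition min_dist dist D : R :=
  inf [set e | exists x y, [/\ D x, D y, x <> y & e = dist x y]].

Definition close_points dist D (x : T) : set T :=
  [set y | D y /\ dist x y <= min_dist dist D].

(* The unordered pair <x, y> is the set {x, y}; x = y is allowed. *)
Definition close_pairs dist D : set (set T) :=
  [set p | exists x y,
    [/\ D x, D y, dist x y <= min_dist dist D & p = [set x; y]]].

(* fset_set A enumerates A when A is finite, as close_pairs is for finite D. *)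
Definition card_close_pairs dist D : nat := #|` fset_set (close_pairs dist D)|%fset.

Lemma finite_close_pairs dist D : finite_set D -> finite_set (close_pairs dist D).
Proof.
move=> finD; have : finite_set [set [set xy.1; xy.2] | xy in D `*` D].
  by apply: finite_image; apply: finite_setX.
apply: sub_finite_set => p [x [y [Dx Dy _ ->]]].
by exists (x, y).
Qed.

End LocalMetric.

(* unif_continuous at the type [subspace V] is uniform continuity of the
   restriction to V; see unif_continuous_subspaceP. *)
Definition locally_unif_continuous (R : realType) (M : metricType R)
    (f : M -> R) : Prop :=
  forall z : M, exists2 V : set M, nbhs z V & unif_continuous (f : subspace V -> R).

Lemma unif_continuous_subspaceP (R : realType) (M : metricType R)
    (V : set M) (f : M -> R) :
  unif_continuous (f : subspace V -> R) <->
  forall e, 0 < e -> exists2 s, 0 < s &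
    forall x y, V x -> V y -> mdist x y < s -> `|f x - f y| < e.
Proof.
split.
- move=> uf e e0.
  have /uf [E + EA] : entourage [set xy : R * R | `|xy.1 - xy.2| < e].
    by rewrite -entourage_ballE; exists e.
  rewrite -entourage_ballE => -[s /= s0 sE]; exists s => // x y Vx Vy xys.
  apply: (EA (x, y)); right; split => //.
  by split => //; apply: sE => /=; rewrite ballEmdist.
- move=> H A; rewrite -entourage_ballE => -[e /= e0 eA].
  have [s s0 sf] := H e e0.
  exists [set xy : M * M | ball xy.1 s xy.2].
    by rewrite -entourage_ballE; exists s.
  move=> [x y] /= [/= ->|[Vx [Vy]]].
    by apply: eA => /=; apply: ballxx.
  by rewrite /= ballEmdist /= => xys; apply: eA; apply: sf.
Qed.

Definition is_modification d (T : measurableType d) (R : realType)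
    (P : probability T R) (M : Type) (psi phi : M -> {RV P >-> R}) : Prop :=
  forall x, P [set w | psi x w = phi x w] = 1%E.

(* Main.v *)
Require Import Defs.
From HB Require Import structures.
From mathcomp Require Import all_boot all_order all_algebra.
From mathcomp Require Import finmap.
From mathcomp Require Import all_classical all_reals all_analysis.
From mathcomp Require Import measurable_realfun.
From mathcomp Require Import lra.

(** The proof is a chaining argument in the manner of Kolmogorov and Chentsov.

    Fix a patch U_n.  The event that some pair of D_{n,k} at d_n-distance at
    most delta_{n,k} has an increment larger than r(delta_{n,k}) has
    probability at most |pi_{n,k}| q(delta_{n,k}), since d <= d_n and since r
    and q increase.  By Borel-Cantelli, almost surely all these increments are
    bounded by r(delta_{n,k}) from some k on ([ae_close_pairs]).  Given two
    points of D_n in a neighborhood V as in (b)(ii), one descends through the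
    sets D_{n,k}, moving each point to a close point at every step while their
    mutual distance does not grow.  If the points are closer than the minimal
    distance of D_{n,m}, the two descents end at the same point of D_{n,m}, and
    both increments are bounded by the tail of the series of r(delta_{n,k})
    after m.  Hence phi is uniformly continuous on the intersection of D_n and
    V ([chaining]); the exceptional null set depends neither on V nor on the
    point around which V was taken, so uncountably many points cause no harm.

    Different patches carry different sets D_n, and the extensions of phi from
    them must agree.  This comes from a second use of Borel-Cantelli: for each
    fixed x in U_n, almost surely phi(x) is the limit of phi along some
    sequence of D_n that tends to x ([ae_limit_value]).  Applied to the
    countably many points of S, the union of all D_n, it shows that phi is
    almost surely uniformly continuous on S near every point of M.  The
    modification psi(x) is then the limit of phi along a fixed sequence of S
    tending to x, and psi = 0 on the exceptional null set.  Measurability is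
    that of a pointwise limit.  Applied to x itself, [ae_limit_value] gives
    psi(x) = phi(x) almost surely, because limits along S are unique. *)

Set Implicit Arguments.
Unset Strict Implicit.
Unset Printing Implicit Defensive.

Import Order.TTheory GRing.Theory Num.Theory.
Import numFieldNormedType.Exports.

Local Open Scope classical_set_scope.
Local Open Scope ring_scope.

(** * Extending uniform continuity from a subset *)

Section Extension.
Context {R : realType} {M : metricType R}.
Implicit Types (V S W : set M) (f g : M -> R) (x y : M) (a b e s : R).

Definition unif_cont_on V f : Prop :=
  forall e, 0 < e -> exists2 s, 0 < s &
    forall x y, V x -> V y -> mdist x y < s -> `|f x - f y| < e.

(** Equivalently, (x, a) lies in the closure of the graph of the restriction of
    f to S.  No limit is asserted to exist: for f uniformly continuous on S near
    x, a is the limit, but the definition makes sense before that is known. *)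
Definition limit_value S f x a : Prop :=
  forall e, 0 < e -> exists y, [/\ S y, mdist x y < e & `|f y - a| < e].

Lemma limit_value_refl S f x : S x -> limit_value S f x (f x).
Proof. by move=> Sx e e0; exists x; rewrite mdistxx subrr normr0. Qed.

Lemma unif_cont_onS (V W : set M) (f : M -> R) :
  V `<=` W -> unif_cont_on W f -> unif_cont_on V f.
Proof.
move=> VW fW e /fW[s s0 fs]; exists s => // x y Vx Vy.
by apply: fs; exact: VW.
Qed.

Lemma limit_valueS (S S' : set M) (f : M -> R) x a :
  S `<=` S' -> limit_value S f x a -> limit_value S' f x a.
Proof.
by move=> SS' fa e /fa[y [Sy xy ya]]; exists y; split => //; exact: SS'.
Qed.

Lemma open_mdist V x : open V -> V x ->
  exists2 s, 0 < s & forall y, mdist x y < s -> V y.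
Proof.
move=> oV Vx; have /nbhs_ballP[s /= s0 sV] : nbhs x V by exact: open_nbhs_nbhs.
by exists s => // y xy; apply: sV; rewrite ballEmdist.
Qed.

(** A modulus of continuity on S passes to limit values, with the same s and e:
    approximants of x and y that are close enough still lie within s of each
    other because mdist x y < s is strict, and in V because V is open. *)
Lemma limit_value_modulus S V f e s x y a b : open V ->
  (forall x' y', (S `&` V) x' -> (S `&` V) y' -> mdist x' y' < s ->
     `|f x' - f y'| < e) ->
  V x -> V y -> mdist x y < s ->
  limit_value S f x a -> limit_value S f y b -> `|a - b| <= e.
Proof.
move=> oV fV Vx Vy xys fa fb; apply/ler_addgt0Pr => t t0.
have [sx sx0 Vsx] := open_mdist oV Vx.
have [sy sy0 Vsy] := open_mdist oV Vy.
have st0 : 0 < (s - mdist x y) / 2 by rewrite divr_gt0// subr_gt0.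
have t20 : 0 < t / 2 by rewrite divr_gt0.
(* c keeps the approximants of x and y in V, within s of each other, and
   their values within t / 2 of a and b. *)
pose c := Num.min (Num.min sx sy) (Num.min ((s - mdist x y) / 2) (t / 2)).
have c0 : 0 < c by rewrite !lt_min sx0 sy0 st0.
have [x' [Sx' + +]] := fa c c0; have [y' [Sy' + +]] := fb c c0.
rewrite !lt_min => /andP[/andP[_ yy1] /andP[yy2 _]] /andP[_ /andP[_ yb]].
move=> /andP[/andP[xx1 _] /andP[xx2 _]] /andP[_ /andP[_ xa]].
have /ltW f' : `|f x' - f y'| < e.
  apply: fV; [by split => //; exact: Vsx|by split => //; exact: Vsy|].
  have := metric_triangle x' x y'; have := metric_triangle x y y'.
  by rewrite (metric_sym x' x); lra.
have -> : a - b = (f x' - f y') - (f x' - a) + (f y' - b) by lra.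
apply: (le_trans (ler_normD _ _)).
have := ler_normB (f x' - f y') (f x' - a).
by move: xa yb f'; lra.
Qed.

Lemma limit_value_unique S V f x a b : open V -> V x ->
  unif_cont_on (S `&` V) f ->
  limit_value S f x a -> limit_value S f x b -> a = b.
Proof.
move=> oV Vx fV fa fb; apply/eqP; rewrite -subr_eq0 -normr_le0.
apply/ler_addgt0Pr => e e0; rewrite add0r.
have [s s0 fs] := fV e e0.
by apply: (limit_value_modulus oV fs Vx Vx _ fa fb); rewrite mdistxx.
Qed.

(** Used twice: with g = f, to pass from D_n to the union of all the D_n, and
    with W the whole space, to pass from that union to M. *)
Lemma unif_cont_on_extend S V W f g : open V ->
  unif_cont_on (S `&` V) f ->
  (forall x, (W `&` V) x -> limit_value S f x (g x)) ->
  unif_cont_on (W `&` V) g.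
Proof.
move=> oV fV fg e e0; have e20 : 0 < e / 2 by rewrite divr_gt0.
have [s s0 fs] := fV _ e20; exists s => // x y WVx WVy xys.
apply: (@le_lt_trans _ _ (e / 2)); last by lra.
by apply: (limit_value_modulus oV fs WVx.2 WVy.2 xys); exact: fg.
Qed.

Lemma unif_cont_on_cvg S V f x (u : nat -> M) : open V -> V x ->
  unif_cont_on (S `&` V) f -> (forall k, S (u k)) ->
  (forall k, mdist x (u k) < k.+1%:R^-1) -> cvgn (f \o u).
Proof.
move=> oV Vx fV Su ux; apply: cauchy_cvg; apply: cauchy_exP => e e0.
have [s s0 fs] := fV e e0; have [t t0 Vt] := open_mdist oV Vx.
pose c := Num.min (s / 2) t.
have c0 : 0 < c by rewrite lt_min t0 divr_gt0.
have [N _ xc] : \forall k \near \oo, mdist x (u k) < c.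
  near=> k; apply: (lt_trans (ux k)).
  by near: k; exact: near_infty_natSinv_lt (PosNum c0).
have xs k : (N <= k)%N -> mdist x (u k) < s / 2 /\ V (u k).
  by move=> /xc /=; rewrite lt_min => /andP[xs /Vt].
exists (f (u N)); exists N => // k /= Nk; rewrite /ball/=.
have [xN VN] := xs N (leqnn N); have [xk Vk] := xs k Nk.
apply: fs => //; have := metric_triangle (u N) x (u k).
by rewrite (metric_sym (u N) x); lra.
Unshelve. all: by end_near. Qed.

(** The point z ranges over the whole space, not only over S: this is what makes
    an extension of f beyond S possible. *)
Definition locally_unif_cont_on (S : set M) (f : M -> R) : Prop :=
  forall z, exists V, [/\ open V, V z & unif_cont_on (S `&` V) f].

Lemma locally_unif_cont_on_extend (S : set M) (f g : M -> R) :
  locally_unif_cont_on S f -> (forall x, limit_value S f x (g x)) ->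
  locally_unif_continuous g.
Proof.
move=> fS fg z; have [V [oV Vz fV]] := fS z.
exists V; first exact: open_nbhs_nbhs.
apply/unif_continuous_subspaceP.
have /(_ _ _) := unif_cont_on_extend oV fV (W := setT) (g := g).
by rewrite setTI; apply => x _.
Qed.
End Extension.

Lemma limit_value_cvg (R : realType) (M : metricType R) (S : set M) (f : M -> R)
    x a (u : nat -> M) :
  (\forall k \near \oo, S (u k)) ->
  (forall k, mdist x (u k) < k.+1%:R^-1) -> f (u k) @[k --> \oo] --> a ->
  limit_value S f x a.
Proof.
move=> Su ux /cvgrPdist_lt fa e e0.
have : \forall k \near \oo, [/\ S (u k), mdist x (u k) < e & `|f (u k) - a| < e].
  near=> k; split.
  - by near: k.
  - apply: (lt_trans (ux k)).
    by near: k; exact: near_infty_natSinv_lt (PosNum e0).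
  - by rewrite distrC; near: k; exact: fa.
by case=> N _ /(_ N (leqnn N)); exists (u N).
Unshelve. all: by end_near. Qed.

(** * Minimal distances in finite sets *)

Section Finite.
Context {R : realType} {T : choiceType}.
Implicit Types (dist : T -> T -> R) (U D : set T).

(** Only the positive entries matter, so that the list of all distances of a
    finite set can be used without removing the zero distances. *)
Lemma seq_pos_lbound (t : seq R) :
  exists2 s : R, 0 < s & forall v, v \in t -> 0 < v -> s <= v.
Proof.
elim: t => [|v t [s s0 st]]; first by exists 1.
have [v0|v0] := ltP 0 v.
  exists (Num.min s v); first by rewrite lt_min s0.
  move=> w; rewrite inE => /orP[/eqP->|wt] w0; first by rewrite ge_min lexx orbT.
  by rewrite ge_min st.
exists s => // w; rewrite inE => /orP[/eqP->|wt] w0; last exact: st.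
by rewrite ltNge v0 in w0.
Qed.

Lemma finite_dist_gap U dist D : metric_on U dist -> finite_set D -> D `<=` U ->
  exists2 s, 0 < s & forall x y, D x -> D y -> dist x y < s -> x = y.
Proof.
move=> [d0 d1 _ _] finD DU.
have /finite_seqP[t tE] : finite_set [set dist xy.1 xy.2 | xy in D `*` D].
  by apply: finite_image; exact: finite_setX.
have [s s0 st] := seq_pos_lbound t; exists s => // x y Dx Dy xys.
apply/(d1 _ _ (DU _ Dx) (DU _ Dy))/eqP; rewrite eq_le d0 ?andbT; try exact: DU.
rewrite leNgt; apply/negP => xy0; move: xys; rewrite ltNge => /negP; apply.
apply: st => //.
suff : [set dist xy.1 xy.2 | xy in D `*` D] (dist x y) by rewrite tE.
by exists (x, y).
Qed.

Lemma min_dist_ge0 U dist D : metric_on U dist -> D `<=` U -> 0 <= min_dist dist D.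
Proof.
move=> [d0 _ _ _] DU; rewrite /min_dist.
set E := (X in inf X); have [->|E0] := eqVneq E set0; first by rewrite inf0.
apply: lb_le_inf; first exact/set0P.
by move=> _ [x [y [Dx Dy _ ->]]]; apply: d0; exact: DU.
Qed.

Lemma min_dist_gt0 U dist D x y : metric_on U dist -> finite_set D -> D `<=` U ->
  D x -> D y -> x <> y -> 0 < min_dist dist D.
Proof.
move=> md finD DU Dx Dy xy; have [s s0 sD] := finite_dist_gap md finD DU.
apply: (lt_le_trans s0); apply: lb_le_inf; first by exists (dist x y), x, y.
move=> _ [x' [y' [Dx' Dy' xy' ->]]]; rewrite leNgt; apply/negP => h.
by apply: xy'; exact: sD.
Qed.

End Finite.

(** * Almost sure events and random variables *)

(** The series is taken in the extended reals, where a finite value means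
    convergence; finite blocks are what the chaining uses. *)
Lemma summable_tail_lt (R : realType) (a : nat -> R) K :
  (forall k, (K <= k)%N -> 0 <= a k) ->
  (\sum_(K <= k <oo) (a k)%:E < +oo)%E ->
  forall e, 0 < e ->
  \forall m \near \oo, forall l, \sum_(m <= k < m + l) a k < e.
Proof.
move=> a0; rewrite eseries_cond /= => asum e e0.
have /(nneseries_tail_cvg asum)/fine_cvgP[afin /cvgrPdist_lt /(_ e e0)] :
    forall k, (K <= k)%N -> (0 <= (a k)%:E)%E.
  by move=> k Kk; rewrite lee_fin a0.
move=> ae; near=> m => l.
have Km : (K <= m)%N by near: m; exact: nbhs_infty_ge.
have afinm : (\sum_(m <= k <oo | (K <= k)%N) (a k)%:E)%E \is a fin_num.
  by near: m.
have : `|0 - fine (\sum_(m <= k <oo | (K <= k)%N) (a k)%:E)%E| < e by near: m.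
rewrite sub0r normrN; apply: le_lt_trans.
apply: le_trans (ler_norm _); rewrite -lee_fin fineK//.
rewrite -(@sumEFin _ _ (index_iota m (m + l)) xpredT).
have mK k : (m <= k)%N -> (K <= k)%N by apply: leq_trans.
have a0' k : (m <= k)%N -> (0 <= (a k)%:E)%E by move=> /mK/a0; rewrite lee_fin.
have -> : (\sum_(m <= k <oo | (K <= k)%N) (a k)%:E = \sum_(m <= k <oo) (a k)%:E)%E.
  rewrite eseries_cond [RHS]eseries_cond; apply: eq_eseriesl => k.
  by case: (leqP m k) => [/mK ->|]; rewrite ?andbF.
rewrite (nneseries_split _ l)// leeDl//.
by apply: nneseries_ge0 => k mlk _; apply: a0'; apply: leq_trans mlk; exact: leq_addr.
Unshelve. all: by end_near. Qed.

Lemma summable_cvg0 (R : realType) (a : nat -> R) K :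
  (forall k, (K <= k)%N -> 0 <= a k) ->
  (\sum_(K <= k <oo) (a k)%:E < +oo)%E ->
  forall e, 0 < e -> \forall k \near \oo, a k < e.
Proof.
move=> a0 asum e e0; have := summable_tail_lt a0 asum e0.
by apply: filterS => m /(_ 1%N); rewrite addn1 big_nat1.
Qed.

Section AlmostSure.
Context d (Omega : measurableType d) (R : realType) (P : probability Omega R).

(** The Borel-Cantelli lemma for events that are controlled only from an index K
    on; the earlier ones are replaced by the empty set. *)
Lemma borel_cantelli_ae (A : nat -> set Omega) (a : nat -> R) K :
  (forall k, (K <= k)%N -> measurable (A k)) ->
  (forall k, (K <= k)%N -> (P (A k) <= (a k)%:E)%E) ->
  (\sum_(K <= k <oo) (a k)%:E < +oo)%E ->
  {ae P, forall w, \forall k \near \oo, ~ A k w}.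
Proof.
move=> mA PA asum.
pose F k := if (K <= k)%N then A k else set0.
have mF k : measurable (F k) by rewrite /F; case: ifP => // /mA.
exists (lim_sup_set F); split.
- by apply: bigcap_measurable => // n _; exact: bigcup_measurable.
- apply: lim_sup_set_cvg0 => //; apply: le_lt_trans asum.
  rewrite [leRHS]eseries_cond [leRHS]eseries_mkcond.
  apply: lee_nneseries => // k _; rewrite /F /=.
  by case: ifP => [/PA//|_]; rewrite measure0.
- move=> w /= nA n _; apply: contrapT => nF; apply: nA.
  exists (maxn n K) => // k /=; rewrite geq_max => /andP[nk Kk] Ak.
  by apply: nF; exists k => //; rewrite /F Kk.
Qed.

Lemma ae_all_nat (Q : nat -> Omega -> Prop) :
  (forall n, {ae P, forall w, Q n w}) -> {ae P, forall w, forall n, Q n w}.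
Proof.
move=> Qae; apply: negligibleS (negligible_bigcup Qae) => w /= /existsNP[n nQ].
by exists n.
Qed.

Lemma ae_all_countable (T : choiceType) (S : set T) (Q : T -> Omega -> Prop) :
  countable S -> (forall x, S x -> {ae P, forall w, Q x w}) ->
  {ae P, forall w, forall x, S x -> Q x w}.
Proof.
move=> /countable_injP[f finj] QS.
have fQ n : {ae P, forall w, forall x, S x -> f x = n -> Q x w}.
  have [[x [Sx fx]]|nx] := pselect (exists x, S x /\ f x = n); last first.
    by apply: aeW => w x Sx fx; case: nx; exists x.
  apply: filterS (QS x Sx) => w Qx y Sy fy.
  by rewrite (_ : y = x)//; apply: finj; rewrite ?inE// fy.
by apply: filterS (ae_all_nat fQ) => w Qw x Sx; exact: (Qw (f x)).
Qed.

Lemma measurable_dist_gt (X Y : {RV P >-> R}) c :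
  measurable [set w | c < `|X w - Y w|].
Proof.
have mXY : measurable_fun setT (fun w => `|X w - Y w|).
  by apply: measurableT_comp => //; exact: measurable_funB.
rewrite [X in measurable X](_ : _ = setT `&` (fun w => `|X w - Y w|) @^-1` `]c, +oo[).
  exact: mXY.
by rewrite setTI; apply/seteqP; split => w /=; rewrite in_itv/= andbT.
Qed.

Lemma random_variable_of_measurable (f : Omega -> R) : measurable_fun setT f ->
  exists X : {RV P >-> R}, X = f :> (Omega -> R).
Proof.
move=> mf.
by exists (HB.pack_for {mfun Omega >-> R} f (isMeasurableFun.Build _ _ _ _ f mf)).
Qed.

Lemma ae_eq_prob1 (X Y : {RV P >-> R}) : {ae P, forall w, X w = Y w} ->
  P [set w | X w = Y w] = 1%E.
Proof.
move=> XY.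
have E : [set w | X w = Y w] = ~` [set w | 0 < `|X w - Y w|].
  apply/seteqP; split => w /=; first by move=> ->; rewrite subrr normr0 ltxx.
  by move=> /negP; rewrite -leNgt normr_le0 subr_eq0 => /eqP.
have mXY := measurable_dist_gt X Y 0.
rewrite E probability_setC// (_ : P _ = 0%E) ?sube0//.
by apply: measure_negligible => //; move: XY; rewrite /prop_near1 /nbhs/= /almost_everywhere E setCK.
Qed.
End AlmostSure.

(** * Oscillation over close pairs *)

Section CloseOscillation.
Context (R : realType) (M : metricType R) (d : measure_display)
  (Omega : measurableType d) (P : probability Omega R) (phi : M -> {RV P >-> R})
  (dist : M -> M -> R).

Definition oscillation_event (D : set M) (c : R) : set Omega :=
  [set w | exists x y, [/\ D x, D y, dist x y <= min_dist dist D &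
    c < `|phi x w - phi y w|]].

(** Indexing by the unordered pair {x, y} counts each pair once, which is what
    the cardinality of close_pairs requires. *)
Let pair_event (c : R) (p : set M) : set Omega :=
  [set w | exists x y, [/\ p x, p y & c < `|phi x w - phi y w|]].

(** 0 <= c excludes the choice of twice the same point of the pair. *)
Let pair_eventE c x y : 0 <= c ->
  pair_event c [set x; y] = [set w | c < `|phi x w - phi y w|].
Proof.
move=> c0; apply/seteqP; split => w /=; last by exists x, y; split; [left|right|].
by case=> _ [_ [[]-> []->]]; rewrite ?subrr ?normr0 ?(distrC (phi y w)) ?(ltNge c) ?c0.
Qed.

Let oscillation_eventE D c : 0 <= c -> oscillation_event D c =
  \bigcup_(p in close_pairs dist D) pair_event c p.
Proof.
move=> c0; apply/seteqP; split => w /=.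
  move=> [x [y [Dx Dy xy cw]]]; exists [set x; y]; first by exists x, y.
  by exists x, y; split => //; [left|right].
move=> [_ [x [y [Dx Dy xy ->]]]].
by rewrite pair_eventE//= => cw; exists x, y.
Qed.

Lemma measurable_oscillation_event D c : 0 <= c -> finite_set D ->
  measurable (oscillation_event D c).
Proof.
move=> c0 finD; rewrite oscillation_eventE//; apply: fin_bigcup_measurable.
  exact: finite_close_pairs.
by move=> _ [x [y [_ _ _ ->]]]; rewrite pair_eventE//; exact: measurable_dist_gt.
Qed.

Lemma oscillation_event_le D c b : 0 <= c -> finite_set D ->
  (forall x y, D x -> D y -> (dist x y <= min_dist dist D)%R ->
    P [set w | (c < `|phi x w - phi y w|)%R] <= b%:E)%E ->
  (P (oscillation_event D c) <= ((card_close_pairs dist D)%:R * b)%:E)%E.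
Proof.
move=> c0 finD Pb; have finp := finite_close_pairs dist finD.
apply: (@le_trans _ _ (\sum_(p \in close_pairs dist D) P (pair_event c p))%E).
  apply: content_sub_fsum => //; last by rewrite oscillation_eventE.
    by move=> _ [x [y [_ _ _ ->]]]; rewrite pair_eventE//; exact: measurable_dist_gt.
  exact: measurable_oscillation_event.
apply: (@le_trans _ _ (\sum_(p \in close_pairs dist D) b%:E)%E).
  apply: lee_fsum => // _ [x [y [Dx Dy xy ->]]].
  by rewrite pair_eventE//; exact: Pb.
rewrite fsbig_finite//= sumEFin lee_fin big_const_seq count_predT iter_addr_0.
by rewrite /card_close_pairs mulr_natl.
Qed.
End CloseOscillation.

(** * Deterministic chaining *)

Lemma subset_leq (T : Type) (D : nat -> set T) :
  (forall k, D k `<=` D k.+1) -> forall i j, (i <= j)%N -> D i `<=` D j.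
Proof.
move=> DS i j /subnK <-; elim: (j - i)%N => // l IH.
by apply: subset_trans IH _; rewrite addSn; exact: DS.
Qed.

(** One descent step of (b)(ii), from D_{k+1} to D_k. *)
Definition chained (R : realType) (M : choiceType) (dist : M -> M -> R)
    (D : nat -> set M) (V : set M) (k : nat) : Prop :=
  forall x y, (D k.+1 `&` V) x -> (D k.+1 `&` V) y ->
    exists x' y',
      [/\ (D k `&` V) x', (D k `&` V) y',
          close_points dist (D k.+1) x x',
          close_points dist (D k.+1) y y' &
          dist x' y' <= dist x y].

Section Chaining.
Context (R : realType) (M : metricType R) (dist : M -> M -> R)
  (D : nat -> set M) (V : set M) (f : M -> R) (a : nat -> R).
Hypothesis D_incr : forall k, D k `<=` D k.+1.

(** Iterating the descent l times: the increments along each of the two chains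
    add up, and the distance between the chains never grows. *)
Lemma chain_down m l :
  (forall k, (m <= k)%N -> chained dist D V k) ->
  (forall k, (m < k)%N -> forall x y, D k x -> D k y ->
    dist x y <= min_dist dist (D k) -> `|f x - f y| <= a k) ->
  forall x y, (D (m + l)%N `&` V) x -> (D (m + l)%N `&` V) y ->
  exists x' y', [/\ (D m `&` V) x', (D m `&` V) y', dist x' y' <= dist x y,
    `|f x - f x'| <= \sum_(m.+1 <= k < m.+1 + l) a k &
    `|f y - f y'| <= \sum_(m.+1 <= k < m.+1 + l) a k].
Proof.
move=> chD fa; elim: l => [|l IH] x y.
  rewrite !addn0 => Dx Dy; exists x, y.
  by rewrite big_geq// !subrr !normr0.
rewrite addnS => Dx Dy.
have [x1 [y1 [Dx1 Dy1 [Dx1' xx1] [Dy1' yy1] xy1]]] :=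
  chD (m + l)%N (leq_addr _ _) x y Dx Dy.
have [x' [y' [Dx' Dy' xy' fx fy]]] := IH x1 y1 Dx1 Dy1.
exists x', y'; split => //; first exact: le_trans xy1.
- rewrite addnS big_nat_recr/= ?leq_addr// addrC.
  apply: le_trans (ler_distD (f x1) _ _) _; apply: lerD => //.
  by apply: fa => //; [rewrite addSn ltnS leq_addr|exact: Dx.1].
- rewrite addnS big_nat_recr/= ?leq_addr// addrC.
  apply: le_trans (ler_distD (f y1) _ _) _; apply: lerD => //.
  by apply: fa => //; [rewrite addSn ltnS leq_addr|exact: Dy.1].
Qed.

(** Since the distance between the two chains does not grow, points that start
    closer than the gap of D_m must reach the same point of D_m; each then
    differs from it by at most a tail of the sum of a. *)
Lemma chaining (U : set M) (c : R) :
  metric_on U dist -> (forall k, finite_set (D k)) -> (forall k, D k `<=` U) ->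
  V `<=` U -> 0 < c -> (forall x y, U x -> U y -> c * dist x y <= mdist x y) ->
  (\forall k \near \oo, chained dist D V k) ->
  (\forall k \near \oo, forall x y, D k x -> D k y ->
    dist x y <= min_dist dist (D k) -> `|f x - f y| <= a k) ->
  (forall e, 0 < e -> \forall m \near \oo, forall l, \sum_(m <= k < m + l) a k < e) ->
  unif_cont_on ((\bigcup_k D k) `&` V) f.
Proof.
move=> md finD DU VU c0 cd chD fa asum e e0.
have [K1 _ chK] := chD; have [K2 _ faK] := fa.
have e20 : 0 < e / 2 by rewrite divr_gt0.
have [K3 _ aK] := asum _ e20.
(* From level m on, descent is possible, close pairs are controlled and the
   tails of the series are below e / 2. *)
pose m := maxn K1 (maxn K2 K3).
have [s s0 sD] := finite_dist_gap md (finD m) (DU m).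
exists (c * s); first exact: mulr_gt0.
move=> x y [[i _ Dx] Vx] [[j _ Dy] Vy] xys.
have DS k : (k <= maxn i j)%N -> D k `<=` D (m + maxn i j)%N.
  by move=> kij; apply: subset_leq => //; apply: leq_trans kij _; exact: leq_addl.
have Dx' : (D (m + maxn i j)%N `&` V) x by split => //; apply: DS Dx; exact: leq_maxl.
have Dy' : (D (m + maxn i j)%N `&` V) y by split => //; apply: DS Dy; exact: leq_maxr.
have [x' [y' [Dmx Dmy xy' fx fy]]] : exists x' y', [/\ (D m `&` V) x',
    (D m `&` V) y', dist x' y' <= dist x y,
    `|f x - f x'| <= \sum_(m.+1 <= k < m.+1 + maxn i j) a k &
    `|f y - f y'| <= \sum_(m.+1 <= k < m.+1 + maxn i j) a k].
  apply: chain_down => // k mk.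
    by apply: chK => /=; apply: leq_trans mk; exact: leq_maxl.
  apply: faK => /=; apply: leq_trans (ltnW mk).
  by rewrite /m leq_max leq_max leqnn orbT.
(* As c * dist <= mdist, points within c * s for mdist are within s for dist. *)
have x'y' : x' = y'.
  apply: sD; [exact: Dmx.1|exact: Dmy.1|apply: le_lt_trans xy' _].
  by rewrite -(ltr_pM2l c0); apply: le_lt_trans xys; apply: cd; exact: VU.
have am : \sum_(m.+1 <= k < m.+1 + maxn i j) a k < e / 2.
  by apply: aK => /=; rewrite leqW// /m !leq_max leqnn !orbT.
have -> : f x - f y = (f x - f x') - (f y - f y') by rewrite x'y'; lra.
apply: le_lt_trans (ler_normB _ _) _; lra.
Qed.

End Chaining.

(** * The random field on one patch *)

Section Patch.
Context (R : realType) (M : metricType R) (d : measure_display)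
  (Omega : measurableType d) (P : probability Omega R) (phi : M -> {RV P >-> R})
  (rho : R) (r q : R -> R).
Hypotheses (r_ge0 : forall t, 0 <= t < rho -> 0 <= r t)
  (q_ge0 : forall t, 0 <= t < rho -> 0 <= q t)
  (r_incr : forall s t, 0 <= s -> s < t -> t < rho -> r s < r t)
  (q_incr : forall s t, 0 <= s -> s < t -> t < rho -> q s < q t)
  (phi_bound : forall x y : M, mdist x y < rho ->
    (P [set w | (r (mdist x y) < `|phi x w - phi y w|)%R] <= (q (mdist x y))%:E)%E).
Context (U : set M) (dist : M -> M -> R) (D : nat -> set M).
Hypotheses (dist_metric : metric_on U dist)
  (mdist_le : forall x y, U x -> U y -> mdist x y <= dist x y)
  (D_finite : forall k, finite_set (D k)) (D_sub : forall k, D k `<=` U)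
  (D_incr : forall k, D k `<=` D k.+1)
  (D_dense : dense_on U dist (\bigcup_k D k)).

Let delta k := min_dist dist (D k).
Let npairs k : R := (card_close_pairs dist (D k))%:R.

Hypothesis summable : exists K : nat,
  [/\ forall k, (K <= k)%N -> delta k < rho,
      (\sum_(K <= k <oo) (npairs k * q (delta k))%:E < +oo)%E &
      (\sum_(K <= k <oo) (r (delta k))%:E < +oo)%E].

Let delta_ge0 k : 0 <= delta k.
Proof. exact: (min_dist_ge0 dist_metric). Qed.

Let incr_le (h : R -> R) : (forall s t, 0 <= s -> s < t -> t < rho -> h s < h t) ->
  forall s t, 0 <= s -> s <= t -> t < rho -> h s <= h t.
Proof.
move=> hi s t s0; rewrite le_eqVlt => /predU1P[->//|st] trho.
by apply: ltW; exact: hi.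
Qed.

(** Monotonicity of r and q allows the distance in the tail bound to be replaced
    by any larger value, such as delta_k. *)
Lemma increment_bound c x y : mdist x y <= c -> c < rho ->
  (P [set w | (r c < `|phi x w - phi y w|)%R] <= (q c)%:E)%E.
Proof.
move=> xyc crho; apply: (@le_trans _ _ (q (mdist x y))%:E); last first.
  by rewrite lee_fin; apply: incr_le => //; exact: mdist_ge0.
apply: le_trans (phi_bound (le_lt_trans xyc crho)).
apply: le_measure; rewrite ?inE; try exact: measurable_dist_gt.
by move=> w /=; apply: le_lt_trans; apply: incr_le => //; exact: mdist_ge0.
Qed.

Lemma ae_close_pairs : {ae P, forall w, \forall k \near \oo, forall x y,
  D k x -> D k y -> dist x y <= delta k -> `|phi x w - phi y w| <= r (delta k)}.
Proof.
have [K [Krho qsum _]] := summable.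
have rd0 k : (K <= k)%N -> 0 <= r (delta k).
  by move=> /Krho drho; rewrite r_ge0// delta_ge0.
have mE k : (K <= k)%N ->
    measurable (oscillation_event phi dist (D k) (r (delta k))).
  by move=> Kk; apply: measurable_oscillation_event => //; exact: rd0.
have PE k : (K <= k)%N -> (P (oscillation_event phi dist (D k) (r (delta k)))
    <= (npairs k * q (delta k))%:E)%E.
  move=> Kk; apply: oscillation_event_le => //; first exact: rd0.
  move=> x y Dx Dy xy; apply: increment_bound; last exact: Krho.
  by apply: le_trans xy; apply: mdist_le; apply: D_sub; eassumption.
apply: filterS (borel_cantelli_ae mE PE qsum) => w; apply: filterS => k nE.
move=> x y Dx Dy xy; rewrite leNgt; apply/negP => rw.
by apply: nE; exists x, y.
Qed.

(** The quantifier on V is inside the almost sure event: the null set is the one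
    of [ae_close_pairs], which does not see V. *)
Lemma ae_unif_cont_on (c : R) : 0 < c ->
  (forall x y, U x -> U y -> c * dist x y <= mdist x y) ->
  {ae P, forall w, forall V, V `<=` U -> (\forall k \near \oo, chained dist D V k) ->
    unif_cont_on ((\bigcup_k D k) `&` V) (fun x => phi x w)}.
Proof.
move=> c0 cd; apply: filterS ae_close_pairs => w wD V VU chD.
apply: (chaining D_incr dist_metric D_finite D_sub VU c0 cd chD wD).
have [K [Krho _ rsum]] := summable.
apply: summable_tail_lt rsum => k Kk.
by rewrite r_ge0// delta_ge0 Krho.
Qed.

(** A point of U outside the dense set is approached by infinitely many points
    of it, so the minimal distances are eventually genuine, hence positive. *)
Lemma eventually_two_points x : U x -> ~ (\bigcup_k D k) x ->
  \forall k \near \oo, exists y z, [/\ D k y, D k z & y <> z].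
Proof.
move=> Ux nDx; have [d0 d1 _ _] := dist_metric.
have [y [i _ Diy] _] := D_dense Ux ltr01.
have Uy : U y by exact: D_sub Diy.
have xy0 : 0 < dist x y.
  rewrite lt_neqAle d0// andbT eq_sym; apply/eqP => /(d1 _ _ Ux Uy) xy.
  by apply: nDx; exists i => //; rewrite xy.
have [z [j _ Djz] xz] := D_dense Ux xy0.
exists (maxn i j) => // k /=; rewrite geq_max => /andP[ik jk].
exists y, z; split; [exact: subset_leq ik _ _|exact: subset_leq jk _ _|].
by move=> yz; rewrite yz ltxx in xz.
Qed.

(** At a point x outside the dense set, delta_k is eventually positive, so there
    is y_k in the dense set within delta_k of x.  The increment from x to y_k
    exceeds r(delta_k) with probability at most q(delta_k), which is at most the
    k-th term of the first series of (c) because there is at least one close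
    pair; Borel-Cantelli applies, and r(delta_k) tends to 0. *)
Lemma ae_limit_value x : U x ->
  {ae P, forall w, limit_value (\bigcup_k D k) (fun y => phi y w) x (phi x w)}.
Proof.
move=> Ux; have [Dx|nDx] := pselect ((\bigcup_k D k) x).
  by apply: aeW => w; exact: limit_value_refl.
have [d0 d1 _ _] := dist_metric.
have [K1 _ two] := eventually_two_points Ux nDx.
have [K0 [K0rho qsum rsum]] := summable.
pose K := maxn K0 K1.
have Krho k : (K <= k)%N -> delta k < rho.
  by rewrite geq_max => /andP[/K0rho].
(* The degenerate pair {y, y} is close as soon as D_k is not empty. *)
have Kdelta k : (K <= k)%N -> 0 < delta k /\ 1 <= npairs k.
  rewrite geq_max => /andP[_ /two[y [z [Dy Dz yz]]]].
  have dk0 : 0 < delta k.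
    by apply: (min_dist_gt0 dist_metric _ _ Dy Dz yz).
  split => //; rewrite /npairs ler1n cardfs_gt0.
  have : close_pairs dist (D k) [set y; y].
    exists y, y; split => //; have Uy := D_sub Dy.
    by rewrite (iffRL (d1 y y Uy Uy) erefl) ltW.
  move=> cp; apply/fset0Pn; exists [set y; y].
  by rewrite in_fset_set ?inE//; exact: finite_close_pairs.
have yP k : exists y, (K <= k)%N ->
    [/\ (\bigcup_k D k) y, mdist x y < k.+1%:R^-1 & mdist x y <= delta k].
  have [Kk|] := leqP K k; last by exists x.
  have m0 : 0 < Num.min k.+1%:R^-1 (delta k).
    by rewrite lt_min invr_gt0 ltr0n/=; have [] := Kdelta k Kk.
  have [y Dy xy] := D_dense Ux m0; exists y => _.
  have Uy : U y by case: Dy => i _; exact: D_sub.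
  move: xy; rewrite lt_min => /andP[xy1 xy2]; have xyd := mdist_le Ux Uy.
  by split => //; [exact: le_lt_trans xy1|rewrite (le_trans xyd)// ltW].
pose y k := sval (cid (yP k)).
have Ky k : (K <= k)%N ->
    [/\ (\bigcup_k D k) (y k), mdist x (y k) < k.+1%:R^-1 & mdist x (y k) <= delta k].
  by rewrite /y; case: cid.
have Pk k : (K <= k)%N ->
    (P [set w | (r (delta k) < `|phi x w - phi (y k) w|)%R]
      <= (npairs k * q (delta k))%:E)%E.
  move=> Kk; have [_ _ xyd] := Ky k Kk; have [_ n1] := Kdelta k Kk.
  apply: le_trans (increment_bound xyd (Krho k Kk)) _.
  by rewrite lee_fin ler_peMl// q_ge0// delta_ge0 Krho.
have qsumK : (\sum_(K <= k <oo) (npairs k * q (delta k))%:E < +oo)%E.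
  apply: le_lt_trans qsum.
  rewrite [leLHS]eseries_cond [leRHS]eseries_cond.
  apply: subset_lee_nneseries => k /=; last by rewrite geq_max => /andP[].
  by move=> k0; rewrite lee_fin mulr_ge0// ?ler0n// q_ge0// delta_ge0 K0rho.
have mP k : (K <= k)%N ->
    measurable [set w | r (delta k) < `|phi x w - phi (y k) w|].
  by move=> _; exact: measurable_dist_gt.
apply: filterS (borel_cantelli_ae mP Pk qsumK) => w ew e e0.
have rd : \forall k \near \oo, r (delta k) < e.
  apply: (summable_cvg0 _ rsum e0) => k Kk.
  by rewrite r_ge0// delta_ge0 K0rho.
suff [N _ /(_ N (leqnn N)) yN] : \forall k \near \oo, [/\ (\bigcup_k D k) (y k),
    mdist x (y k) < e & `|phi (y k) w - phi x w| < e] by exists (y N).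
near=> k.
have Kk : (K <= k)%N by near: k; exact: nbhs_infty_ge.
have [Dy xyk _] := Ky k Kk; split => //.
  by apply: lt_trans xyk _; near: k; exact: near_infty_natSinv_lt (PosNum e0).
have /negP : ~ (r (delta k) < `|phi x w - phi (y k) w|) by near: k.
rewrite -leNgt distrC => /le_lt_trans; apply; near: k; exact: rd.
Unshelve. all: by end_near. Qed.

End Patch.

(** * Gluing the patches *)

Theorem theorem2p4 (R : realType) (M : metricType R) (sepM : separable_space M)
  (disp : measure_display) (Omega : measurableType disp) (P : probability Omega R)
  (phi : M -> {RV P >-> R})
  (rho : R) (rho_gt0 : 0 < rho) (r q : R -> R)
  (r_ge0 : forall t : R, 0 <= t < rho -> 0 <= r t)
  (q_ge0 : forall t : R, 0 <= t < rho -> 0 <= q t)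
  (r_incr : forall s t : R, 0 <= s -> s < t -> t < rho -> r s < r t)
  (q_incr : forall s t : R, 0 <= s -> s < t -> t < rho -> q s < q t)
  (r0 : r 0 = 0) (q0 : q 0 = 0)
  (phi_bound : forall x y : M, mdist x y < rho ->
    (P [set w | (r (mdist x y) < `|phi x w - phi y w|)%R] <= (q (mdist x y))%:E)%E)
  (* (a) *)
  (U : nat -> set M) (U_open : forall n, open (U n))
  (U_cover : \bigcup_n U n = [set: M])
  (dloc : nat -> M -> M -> R) (dloc_metric : forall n, metric_on (U n) (dloc n))
  (alpha : nat -> R) (alpha_range : forall n, 0 < alpha n <= 1)
  (dloc_equiv : forall n x y, U n x -> U n y ->
    alpha n * dloc n x y <= mdist x y <= dloc n x y)
  (* (b)(i) *)
  (D : nat -> nat -> set M)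
  (D_finite : forall n k, finite_set (D n k))
  (D_sub : forall n k, D n k `<=` U n)
  (D_incr : forall n k, D n k `<=` D n k.+1)
  (D_dense : forall n, dense_on (U n) (dloc n) (\bigcup_k D n k))
  (* (b)(ii) *)
  (D_chain : forall n z, U n z ->
    exists V : set M, [/\ nbhs z V, V `<=` U n &
      \forall k \near \oo, forall x y : M,
        (D n k.+1 `&` V) x -> (D n k.+1 `&` V) y ->
        exists x' y' : M,
          [/\ (D n k `&` V) x', (D n k `&` V) y',
              close_points (dloc n) (D n k.+1) x x',
              close_points (dloc n) (D n k.+1) y y' &
              dloc n x' y' <= dloc n x y]])
  (* (c) *)
  (summable : forall n, exists K : nat,
    [/\ forall k, (K <= k)%N -> min_dist (dloc n) (D n k) < rho,
        (\sum_(K <= k <oo) ((card_close_pairs (dloc n) (D n k))%:R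
                            * q (min_dist (dloc n) (D n k)))%:E < +oo)%E &
        (\sum_(K <= k <oo) (r (min_dist (dloc n) (D n k)))%:E < +oo)%E]) :
  exists psi : M -> {RV P >-> R},
    is_modification psi phi /\
    forall w : Omega, locally_unif_continuous (fun x => psi x w).
Proof.
pose Dn n := \bigcup_k D n k.
pose S := \bigcup_n Dn n.
have DnS n : Dn n `<=` S by move=> x Dx; exists n.
have cS : countable S.
  by do 2 (apply: bigcup_countable => // ? _); exact: finite_set_countable.
have Ux x : exists n, U n x by have [n _ Un] : (\bigcup_n U n) x; [rewrite U_cover|exists n].
have dle n x y : U n x -> U n y -> mdist x y <= dloc n x y.
  by move=> Unx Uny; have /andP[] := dloc_equiv n x y Unx Uny.
have lim_n n x : U n x ->
    {ae P, forall w, limit_value (Dn n) (fun y => phi y w) x (phi x w)}.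
  exact: (ae_limit_value r_ge0 q_ge0 r_incr q_incr phi_bound (dloc_metric n)
    (dle n) (D_finite n) (D_sub n) (D_incr n) (D_dense n) (summable n)).
have good : {ae P, forall w, locally_unif_cont_on S (fun x => phi x w)}.
  have lim_S : {ae P, forall w, forall n, forall x, S x -> U n x ->
      limit_value (Dn n) (fun y => phi y w) x (phi x w)}.
    apply: ae_all_nat => n; apply: (ae_all_countable cS) => x _.
    have [Unx|nUnx] := pselect (U n x); last by apply: aeW.
    by apply: filterS (lim_n n x Unx).
  have uc_n : {ae P, forall w, forall n, forall V, V `<=` U n ->
      (\forall k \near \oo, chained (dloc n) (D n) V k) ->
      unif_cont_on (Dn n `&` V) (fun x => phi x w)}.
    apply: ae_all_nat => n.
    have /andP[an0 _] := alpha_range n.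
    have adle x y : U n x -> U n y -> alpha n * dloc n x y <= mdist x y.
      by move=> Unx Uny; have /andP[] := dloc_equiv n x y Unx Uny.
    exact: (ae_unif_cont_on r_ge0 r_incr q_incr phi_bound (dloc_metric n)
      (dle n) (D_finite n) (D_sub n) (D_incr n) (summable n) an0 adle).
  move: lim_S uc_n; apply: filterS2 => w lw ucw z.
  have [n Unz] := Ux z; have [V [Vz VU chV]] := D_chain n z Unz.
  (* V itself may not be open, and shrinking it could break the descent
     property: uniform continuity is restricted to the interior only now. *)
  have oV : open V° := @open_interior _ V.
  exists V°; split => //.
  apply: (unif_cont_on_extend oV (unif_cont_onS _ (ucw n V VU chV))).
    by apply: setIS; exact: interior_subset.
  by move=> x [Sx /interior_subset/VU Unx]; exact: lw.
have [N [mN PN0 goodN]] := good.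
have uP x k : exists y, S y /\ mdist x y < k.+1%:R^-1.
  have [n Unx] := Ux x; have k0 : (0 : R) < k.+1%:R^-1 by rewrite invr_gt0 ltr0n.
  have [y Dy xy] := D_dense n x Unx _ k0; exists y; split; first exact: DnS Dy.
  apply: le_lt_trans xy; apply: dle => //; have [j _] := Dy; exact: D_sub.
pose u x k := sval (cid (uP x k)).
have uS x k : S (u x k) by rewrite /u; case: cid => y [].
have ux x k : mdist x (u x k) < k.+1%:R^-1 by rewrite /u; case: cid => y [].
(* Multiplying by the indicator makes the sequence converge at every w, so
   that its limit is measurable on the whole of Omega. *)
pose h x k w := phi (u x k) w * \1_(~` N) w.
have hN x k w : N w -> h x k w = 0 by move=> Nw; rewrite /h indicE memNset ?mulr0//=; apply.
have hnN x k w : ~ N w -> h x k w = phi (u x k) w.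
  by move=> Nw; rewrite /h indicE mem_set ?mulr1.
have goodw w : ~ N w -> locally_unif_cont_on S (fun x => phi x w).
  by move=> Nw; apply: contrapT => /goodN.
have hcvg x w : cvgn (h x ^~ w).
  have [Nw|Nw] := pselect (N w).
    by rewrite (_ : h x ^~ w = cst 0); [exact: is_cvg_cst|apply/funext => k; exact: hN].
  rewrite (_ : h x ^~ w = (phi ^~ w) \o u x); last by apply/funext => k; exact: hnN.
  have [V [oV Vx fV]] := goodw w Nw x.
  exact: (unif_cont_on_cvg oV Vx fV).
have psiP x : exists X : {RV P >-> R}, X = (fun w => limn (h x ^~ w)) :> (Omega -> R).
  apply: random_variable_of_measurable.
  apply: (measurable_fun_cvg (h := h x)) => [k|w _]; last exact: hcvg.
  by apply: measurable_funM => //; apply: measurable_indic; exact: measurableC.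
pose psi x := sval (cid (psiP x)).
have psiE x w : psi x w = limn (h x ^~ w) by rewrite /psi; case: cid => X /= ->.
have psi_lim w : ~ N w -> forall x, limit_value S (phi ^~ w) x (psi x w).
  move=> Nw x; apply: (limit_value_cvg (u := u x)) => //; first exact: nearW.
  rewrite psiE; have := hcvg x w; rewrite (_ : h x ^~ w = (phi ^~ w) \o u x)//.
  by apply/funext => k; exact: hnN.
exists psi; split.
  move=> x; apply: ae_eq_prob1.
  have [n Unx] := Ux x.
  have nN : {ae P, forall w, ~ N w} by exists N; split => // w /contrapT.
  move: nN (lim_n n x Unx); apply: filterS2 => w Nw /(limit_valueS (DnS n)) phix.
  have [V [oV Vx fV]] := goodw w Nw x.
  exact: limit_value_unique oV Vx fV (psi_lim w Nw x) phix.
move=> w; have [Nw|Nw] := pselect (N w); last first.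
  exact: locally_unif_cont_on_extend (goodw w Nw) (psi_lim w Nw).
move=> z; exists setT; first exact: filterT.
apply/unif_continuous_subspaceP => e e0; exists 1 => // x y _ _ _.
have psi0 x' : psi x' w = 0.
  rewrite psiE (_ : h x' ^~ w = cst 0); first exact: lim_cst.
  by apply/funext => k; exact: hN.
by rewrite !psi0 subrr normr0.
Qed.
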